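(* (Expectation model.) For each $t\in\mathbb N$ let $\bar a(t)\in\mathbb R_{\ge 0}^{n+1}$ and $\bar\alpha(t)\in[0,1]^{n+1}$, and let $\bar A(t)=I_{n+1}-\mathrm{diag}(\bar\alpha(t))$. Consider any initial condition $\bar x_0\in\mathbb R_{\ge 0}^{n+1}$ and any input sequence $c:\mathbb N\to\mathbb R^{n+1}$ such that $0\le c(t)\le \bar x(t)$ for all $t\in\mathbb N$, where $\bar x$ is the solution of $$\bar x(t+1)=\bar A(t)\,[\bar x(t)+Bc(t)]+\bar a(t),\qquad \bar x(0)=\bar x_0 .$$ Then $\bar x(t)\ge 0$ for all $t\in\mathbb N$. The system is also monotonic in $x$: for all $t\in\mathbb N$, if $x,y\in\mathbb R^{n+1}$ satisfy $y\ge x\ge c(t)$, then $$\bar A(t)\,[y+Bc(t)]+\bar a(t)\ \ge\ \bar A(t)\,[x+Bc(t)]+\bar a(t).$$ (Stochastic model.) Moreover, let $a:\mathbb N\to\mathbb N^{n+1}$ be any integer-valued arrival sample path, let the departures satisfy the binomial departure model described in the context, and let $x_0\in\mathbb N^{n+1}$. If $c:\mathbb N\to\mathbb N^{n+1}$ satisfies $0\le c(t)\le x(t)$ for all $t\in\mathbb N$, where $x$ is the solution of $$x(t+1)=A(t)\,[x(t)+Bc(t)]+a(t),\qquad x(0)=x_0,$$ then $x(t)\in\mathbb N^{n+1}$ for all $t\in\mathbb N$.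
   Context: $\mathbb N$ denotes the nonnegative integers and $n\in\mathbb N$ is fixed. Vector and matrix inequalities are component-wise. Vectors in $\mathbb R^{n+1}$ are indexed by $i=0,\ldots,n$. The matrix $B\in\mathbb R^{(n+1)\times(n+1)}$ has $-1$ on the main diagonal, $1$ on the first superdiagonal, and $0$ elsewhere, so that $[Bc]_i=-c_i+c_{i+1}$ for $i=0,\ldots,n$ with the convention $c_{n+1}=0$. By the model's standing convention, the charging input satisfies $c_0(t)=0$ for all $t$. Interpretation: $x_i(t)$ is the number of vehicles of class $i$ (needing $i$ further charging intervals) present during time interval $t$, $c_i(t)$ the number of those being charged, $a_i(t)$ the number of arrivals, $d_i(t)$ the number of departures. Binomial departure model: set $h_i(t)=x_i(t)-c_i(t)+c_{i+1}(t)$ for $i=0,\ldots,n$. Let $\mathcal F_t$ denote the information available up to time $t$; after the charging action $c(t)$ is selected, $h_i(t)$ is $\mathcal F_t$-measurable. Conditionally on $\mathcal F_t$, the number of departures $d_i(t)$ is distributed as $\mathrm{Bin}(h_i(t),\bar\alpha_i(t))$ with $\bar\alpha_i(t)\in[0,1]$; in particular $d_i(t)$ takes values in $\{0,1,\ldots,h_i(t)\}$. The realized departure fractions are $\alpha_i(t)=d_i(t)/h_i(t)$ if $h_i(t)>0$ and $\alpha_i(t)=0$ if $h_i(t)=0$; and $A(t)=I_{n+1}-\mathrm{diag}(\alpha_0(t),\ldots,\alpha_n(t))$. Equivalently, $x_i(t+1)=h_i(t)-d_i(t)+a_i(t)$. *)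

(* Defs.v *)
From HB Require Import structures.
From mathcomp Require Import all_boot all_order all_algebra.
From mathcomp Require Import all_classical all_reals all_analysis.

Set Implicit Arguments.
Unset Strict Implicit.
Unset Printing Implicit Defensive.

Import Order.TTheory GRing.Theory Num.Theory.
Import numFieldNormedType.Exports.

Local Open Scope classical_set_scope.
Local Open Scope ring_scope.

(* MathComp puts no order on matrices. *)
Definition vle (R : realType) (m : nat) (u v : 'cV[R]_m) : Prop :=
  forall i, u i 0 <= v i 0.

Definition natv (R : realType) (m : nat) (v : 'cV[nat]_m) : 'cV[R]_m :=
  map_mx (fun k : nat => k%:R) v.

Definition Bmx (R : realType) (n : nat) : 'M[R]_n.+1 :=
  \matrix_(i, j) (if (j : nat) == i then -1
                  else if (j : nat) == i.+1 then 1 else 0).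

Definition Amx (R : realType) (n : nat) (alpha : 'cV[R]_n.+1) : 'M[R]_n.+1 :=
  1%:M - diag_mx alpha^T.

Definition step (R : realType) (n : nat) (alpha a x c : 'cV[R]_n.+1) :
    'cV[R]_n.+1 :=
  Amx alpha *m (x + Bmx R n *m c) + a.

(* c_(i+1), with c_(n+1) = 0 *)
Definition next (R : realType) (n : nat) (c : 'cV[R]_n.+1) (i : 'I_n.+1) : R :=
  if (i.+1 < n.+1)%N then c (inord i.+1) 0 else 0.

Definition after_charge (R : realType) (n : nat) (x c : 'cV[R]_n.+1) :
    'cV[R]_n.+1 :=
  \col_i (x i 0 - c i 0 + next c i).

Lemma BmxE (R : realType) (n : nat) (c : 'cV[R]_n.+1) (i : 'I_n.+1) :
  (Bmx R n *m c) i 0 = - c i 0 + next c i.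
Proof.
rewrite mxE (bigD1 i) //= mxE eqxx mulN1r; congr (_ + _).
rewrite /next; case: ifPn => [lt_in|ge_in].
  rewrite (bigD1 (inord i.+1)) /=; last first.
    by apply/eqP => /(congr1 val); rewrite /= inordK // => /esym/n_Sn.
  rewrite mxE inordK // gtn_eqF // eqxx mul1r big1 ?addr0 // => j /andP[ji jSi].
  rewrite mxE (negbTE (ji : (j : nat) != i)); case: eqP => [eji|_].
    by case/eqP: jSi; apply: val_inj; rewrite /= inordK.
  by rewrite mul0r.
rewrite big1 // => j ji.
rewrite mxE (negbTE (ji : (j : nat) != i)); case: eqP => [eji|_].
  by case/negP: ge_in; rewrite -eji.
by rewrite mul0r.
Qed.

Lemma after_chargeE (R : realType) (n : nat) (x c : 'cV[R]_n.+1) :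
  after_charge x c = x + Bmx R n *m c.
Proof.
by apply/matrixP => i j; rewrite ord1 [RHS]mxE BmxE mxE addrA.
Qed.

Definition fractions (R : realType) (n : nat) (h : 'cV[R]_n.+1)
    (d : 'cV[nat]_n.+1) : 'cV[R]_n.+1 :=
  \col_i (if 0 < h i 0 then (d i 0)%:R / h i 0 else 0).

Record filtration (disp : measure_display) (Omega : measurableType disp)
    (F : nat -> set (set Omega)) : Prop := Filtration {
  filtration_sigma : forall t, sigma_algebra setT (F t);
  filtration_sub : forall t, F t `<=` measurable;
  filtration_mono : forall s t, (s <= t)%N -> F s `<=` F t
}.

(* Conditionally on the sigma-algebra G, N has law Bin(h, p), by the defining
   property of a conditional distribution. Since Bin(h, p) only makes sense for
   natural h, nothing is required outside of the event that h is natural; this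
   way the notion does not presuppose that h is natural-valued. *)
Definition cond_binomial (R : realType) (disp : measure_display)
    (Omega : measurableType disp) (P : probability Omega R)
    (G : set (set Omega)) (h : Omega -> R) (p : R) (N : Omega -> nat) : Prop :=
  forall (E : set Omega) (U : set nat), G E ->
    (forall w, E w -> h w \is a Num.nat) ->
    P (E `&` N @^-1` U) =
      (\int[P]_(w in E) binomial_prob (Num.truncn (h w)) p U)%E.

Record binomial_departures (R : realType) (n : nat) (disp : measure_display)
    (Omega : measurableType disp) (P : probability Omega R)
    (F : nat -> set (set Omega)) (alphabar : nat -> 'cV[R]_n.+1)
    (h : nat -> Omega -> 'cV[R]_n.+1) (d : nat -> Omega -> 'cV[nat]_n.+1) :
    Prop := BinomialDepartures {
  departures_filtration : filtration F;
  departures_adapted : forall t i (Y : set R), measurable Y ->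
    F t [set w | Y (h t w i 0)];
  departures_measurable : forall t i (U : set nat),
    measurable [set w | U (d t w i 0)];
  departures_law : forall t i,
    cond_binomial P (F t) (fun w => h t w i 0) (alphabar t i 0)
      (fun w => d t w i 0)
}.

(* Main.v *)
Require Import Defs.
From HB Require Import structures.
From mathcomp Require Import all_boot all_order all_algebra.
From mathcomp Require Import all_classical all_reals all_analysis.

Set Implicit Arguments.
Unset Strict Implicit.
Unset Printing Implicit Defensive.

Import Order.TTheory GRing.Theory Num.Theory.
Import numFieldNormedType.Exports.

Local Open Scope classical_set_scope.
Local Open Scope ring_scope.

(** Coordinatewise, one step of the dynamics is
    [x_i(t+1) = (1 - alpha_i(t)) * h_i(t) + a_i(t)], with
    [h_i = x_i - c_i + c_(i+1)] ([step_coord]).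

    Expectation model. If [0 <= c <= x] then [h >= 0], and the factor
    [1 - alpha_i] is nonnegative, so nonnegativity propagates in time. As [h] is
    a translate of [x], the same factor makes the step nondecreasing in [x].

    Stochastic model. For a natural [h_i] and the realized fractions
    [alpha_i = d_i / h_i], the step is [x_i(t+1) = h_i - d_i + a_i] if [h_i > 0],
    and [a_i] if [h_i = 0]; it is therefore natural as soon as [d_i <= h_i]
    ([step_fractions_nat]). If [x] is natural and [c <= x], then [h] is natural,
    so along one sample path integrality propagates provided that
    [d_i(t) <= h_i(t)] holds whenever [h_i(t)] is natural ([path_nat]).

    That proviso holds almost surely ([cond_binomial_le]): for each natural [k],
    the event [h_i(t) = k] belongs to [F_t], and the conditional law [Bin(k, p)]
    puts no mass above [k], so the event [h_i(t) = k, d_i(t) > k] is null. Only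
    countably many triples [(t, i, k)] occur. *)

Lemma step_coord (R : realType) (n : nat) (alpha a x c : 'cV[R]_n.+1)
    (i : 'I_n.+1) :
  step alpha a x c i 0 = (1 - alpha i 0) * after_charge x c i 0 + a i 0.
Proof.
rewrite /step /Amx -after_chargeE mulmxBl mul1mx mul_diag_mx.
by rewrite !mxE mulrBl mul1r.
Qed.

Lemma next_ge0 (R : realType) (n : nat) (c : 'cV[R]_n.+1) (i : 'I_n.+1) :
  vle 0 c -> 0 <= Defs.next c i.
Proof.
move=> c0; rewrite /Defs.next; case: ifP => // _.
by have := c0 (inord i.+1); rewrite mxE.
Qed.

Lemma after_charge_ge0 (R : realType) (n : nat) (x c : 'cV[R]_n.+1)
    (i : 'I_n.+1) :
  vle 0 c -> vle c x -> 0 <= after_charge x c i 0.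
Proof. by move=> c0 cx; rewrite mxE addr_ge0 ?next_ge0// subr_ge0. Qed.

Lemma after_charge_mono (R : realType) (n : nat) (x y c : 'cV[R]_n.+1) :
  vle x y -> vle (after_charge x c) (after_charge y c).
Proof. by move=> xy i; rewrite !mxE !lerD2r. Qed.

Lemma step_ge0 (R : realType) (n : nat) (alpha a x c : 'cV[R]_n.+1) :
  (forall i, alpha i 0 <= 1) -> vle 0 a -> vle 0 c -> vle c x ->
  vle 0 (step alpha a x c).
Proof.
move=> alpha1 a0 c0 cx i; rewrite mxE step_coord addr_ge0//.
  by rewrite mulr_ge0 ?after_charge_ge0// subr_ge0.
by have := a0 i; rewrite mxE.
Qed.

Lemma step_mono (R : realType) (n : nat) (alpha a x y c : 'cV[R]_n.+1) :
  (forall i, alpha i 0 <= 1) -> vle x y ->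
  vle (step alpha a x c) (step alpha a y c).
Proof.
move=> alpha1 xy i; rewrite !step_coord lerD2r ler_wpM2l ?subr_ge0//.
exact: after_charge_mono.
Qed.

Lemma next_nat (R : realType) (n : nat) (c : 'cV[nat]_n.+1) (i : 'I_n.+1) :
  Defs.next (natv R c) i \is a Num.nat.
Proof. by rewrite /Defs.next; case: ifP => // _; rewrite mxE. Qed.

Lemma after_charge_nat (R : realType) (n : nat) (x : 'cV[R]_n.+1)
    (c : 'cV[nat]_n.+1) (i : 'I_n.+1) :
  x \is a mxOver Num.nat -> vle (natv R c) x ->
  after_charge x (natv R c) i 0 \is a Num.nat.
Proof.
move=> /mxOverP /(_ i 0) xN cx; rewrite mxE rpredD ?next_nat//.
have [k xk] := natrP xN; move: (cx i); rewrite xk mxE ler_nat => ck.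
by rewrite -natrB ?natr_nat.
Qed.

(** When [h_i = 0] the realized fraction is [0] and the new state is [a_i]. *)
Lemma step_fractions_nat (R : realType) (n : nat) (x c : 'cV[R]_n.+1)
    (a d : 'cV[nat]_n.+1) (i : 'I_n.+1) :
  after_charge x c i 0 \is a Num.nat -> (d i 0)%:R <= after_charge x c i 0 ->
  step (fractions (after_charge x c) d) (natv R a) x c i 0 \is a Num.nat.
Proof.
rewrite step_coord.
have -> : fractions (after_charge x c) d i 0 =
    if 0 < after_charge x c i 0 then (d i 0)%:R / after_charge x c i 0 else 0.
  by rewrite [LHS]mxE.
have -> : natv R a i 0 = (a i 0)%:R by rewrite mxE.
move: (after_charge x c i 0) => h /natrP[k ->{h}]; rewrite ler_nat => dk.
rewrite rpredD ?natr_nat//; case: ifPn => [k0|_]; last first.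
  by rewrite subr0 mul1r natr_nat.
by rewrite mulrBl mul1r divfK ?gt_eqF// -natrB ?natr_nat.
Qed.

(** The bound on the departures is required only where [h] is natural, so that
    it is available from the conditional law before integrality is known. *)
Lemma path_nat (R : realType) (n : nat) (a c d : nat -> 'cV[nat]_n.+1)
    (x0 : 'cV[nat]_n.+1) (x h : nat -> 'cV[R]_n.+1) :
  (forall t, h t = after_charge (x t) (natv R (c t))) ->
  x 0%N = natv R x0 ->
  (forall t, x t.+1 =
    step (fractions (h t) (d t)) (natv R (a t)) (x t) (natv R (c t))) ->
  (forall t i, h t i 0 \is a Num.nat -> (d t i 0)%:R <= h t i 0) ->
  (forall t, vle (natv R (c t)) (x t)) ->
  forall t, x t \is a mxOver Num.nat.
Proof.
move=> hE x_0 xS dh cx; elim=> [|t IHt]; apply/mxOverP => i j; rewrite ord1.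
  by rewrite x_0 mxE.
have hN : h t i 0 \is a Num.nat by rewrite hE after_charge_nat.
by have := dh t i hN; move: hN; rewrite xS !hE; exact: step_fractions_nat.
Qed.

Lemma binomial_prob_gt (R : realType) (k : nat) (p : R) :
  0 <= p <= 1 -> binomial_prob k p [set m | (k < m)%N] = 0%E.
Proof.
move=> p01; rewrite /binomial_prob p01 esum1// => m /= km.
by rewrite /binomial_pmf bin_small// mulr0n.
Qed.

(** The conclusion is restricted to natural values of [h] because the
    conditional law constrains [N] only there. *)
Lemma cond_binomial_le (R : realType) (disp : measure_display)
    (Omega : measurableType disp) (P : probability Omega R)
    (G : set (set Omega)) (h : Omega -> R) (p : R) (N : Omega -> nat) :
  0 <= p <= 1 -> G `<=` measurable ->
  (forall k : nat, G [set w | h w = k%:R]) ->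
  (forall U : set nat, measurable (N @^-1` U)) ->
  cond_binomial P G h p N ->
  {ae P, forall w, h w \is a Num.nat -> (N w)%:R <= h w}.
Proof.
move=> p01 Gm Gh mN law.
(* Fixing the value k of h makes the integrand below identically zero. *)
have bad0 k : P.-negligible
    ([set w | h w = k%:R] `&` N @^-1` [set m | (k < m)%N]).
  apply/negligibleP; first by apply: measurableI; [exact: Gm|exact: mN].
  transitivity (\int[P]_(w in [set w | h w = k%:R])
      binomial_prob (Num.truncn (h w)) p [set m | (k < m)%N])%E.
    by apply: law => // w /= ->.
  by apply: integral0_eq => w /= ->; rewrite natrK binomial_prob_gt.
apply: negligibleS (negligible_bigcup bad0) => w /= /not_implyP[/natrP[k hk] Nh].
by exists k => //; split=> //=; rewrite ltnNge -(ler_nat R) -hk; apply/negP.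
Qed.

Theorem lemma2p1 (R : realType) (n : nat) (alphabar : nat -> 'cV[R]_n.+1)
    (halphabar : forall t i, 0 <= alphabar t i 0 <= 1) :
  (* expectation model *)
  (forall (abar : nat -> 'cV[R]_n.+1) (xbar0 : 'cV[R]_n.+1)
      (c xbar : nat -> 'cV[R]_n.+1),
    (forall t, vle 0 (abar t)) ->
    vle 0 xbar0 ->
    xbar 0%N = xbar0 ->
    (forall t, xbar t.+1 = step (alphabar t) (abar t) (xbar t) (c t)) ->
    (forall t, c t ord0 0 = 0) ->
    (forall t, vle 0 (c t) /\ vle (c t) (xbar t)) ->
    (forall t, vle 0 (xbar t)) /\
    (forall t (x y : 'cV[R]_n.+1), vle x y -> vle (c t) x ->
      vle (step (alphabar t) (abar t) x (c t))
          (step (alphabar t) (abar t) y (c t))))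
  /\
  (* stochastic model *)
  (forall (disp : measure_display) (Omega : measurableType disp)
      (P : probability Omega R) (F : nat -> set (set Omega))
      (a c d : nat -> Omega -> 'cV[nat]_n.+1) (x0 : 'cV[nat]_n.+1)
      (x h : nat -> Omega -> 'cV[R]_n.+1),
    (forall t w, h t w = after_charge (x t w) (natv R (c t w))) ->
    binomial_departures P F alphabar h d ->
    (forall w, x 0%N w = natv R x0) ->
    (forall t w, x t.+1 w =
      step (fractions (h t w) (d t w)) (natv R (a t w)) (x t w)
        (natv R (c t w))) ->
    (forall t w, c t w ord0 0 = 0%N) ->
    (* almost surely, from the conditional law alone *)
    {ae P, forall w,
      (forall t, vle 0 (natv R (c t w)) /\ vle (natv R (c t w)) (x t w)) ->
      forall t, x t w \is a mxOver Num.nat}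
    /\
    (* on every sample path whose departures lie in {0, ..., h_i(t)} *)
    (forall w,
      (forall t i, (d t w i 0)%:R <= h t w i 0) ->
      (forall t, vle 0 (natv R (c t w)) /\ vle (natv R (c t w)) (x t w)) ->
      forall t, x t w \is a mxOver Num.nat)).
Proof.
have alphabar1 t i : alphabar t i 0 <= 1 by case/andP: (halphabar t i).
split=> [abar xbar0 c xbar abar0 x00 x_0 xS _ hc|].
  split=> [[|t]|t x y xy _]; first by rewrite x_0.
    by rewrite xS; have [c0 cx] := hc t; exact: step_ge0.
  exact: step_mono.
move=> disp Omega P F a c d x0 x h hE [filtF adaptF measd law] x_0 xS _.
split=> [|w dh cx]; last first.
  apply: (path_nat (fun t => hE t w) (x_0 w) (fun t => xS t w)) => t.
    by move=> i _; exact: dh.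
  by have [] := cx t.
have dh : {ae P, forall w t i,
    h t w i 0 \is a Num.nat -> (d t w i 0)%:R <= h t w i 0}.
  apply: ae_foralln => t; apply: filter_forall => i.
  apply: (cond_binomial_le (halphabar t i) _ _ _ (law t i)) => [|k|U].
  - exact: filtration_sub.
  - exact: (adaptF t i [set k%:R]).
  - exact: measd.
apply: filterS dh => w dh cx.
apply: (path_nat (fun t => hE t w) (x_0 w) (fun t => xS t w)) => // t.
by have [] := cx t.
Qed.
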